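(* Let $m\ge 1$, let $\mathcal{P}$ be a probability distribution on $\mathbb{R}^m$ whose support is contained in a bounded subset of $\mathbb{R}^m$, and let $\mathcal{G}$ be a non-degenerate $m$-dimensional Gaussian distribution (i.e. with positive definite covariance). Then for every $\epsilon>0$ there exists a fully connected feed-forward neural network $u:\mathbb{R}^m\to\mathbb{R}$ with ReLU activations (of sufficiently large width and depth, depending on $\epsilon$) such that $$\mathcal{W}_2^2\big(\mathcal{P},\ \nabla u(\mathcal{G})\big)<\epsilon,$$ where $\nabla u(\mathcal{G})$ denotes the distribution of $\nabla u(\xi)$ for $\xi\sim\mathcal{G}$.
   Context: For probability distributions $\mathcal{P},\mathcal{Q}$ on $\mathbb{R}^m$ with finite second moment, the 2-Wasserstein distance is $\mathcal{W}_2(\mathcal{P},\mathcal{Q})=\big(\inf_{\gamma\in\Gamma(\mathcal{P},\mathcal{Q})}\int\|Z-Z'\|_2^2\,d\gamma(Z,Z')\big)^{1/2}$, where $\Gamma(\mathcal{P},\mathcal{Q})$ is the set of couplings (joint distributions of $(Z,Z')$ with marginals $\mathcal{P}$ and $\mathcal{Q}$). The map $\nabla u:\mathbb{R}^m\to\mathbb{R}^m$ is the gradient of the network $u$ (a piecewise-linear function, so $\nabla u$ is defined Lebesgue-almost everywhere, hence $\mathcal{G}$-almost surely), and $\nabla u(\mathcal{G})$ is the pushforward of $\mathcal{G}$ under $\nabla u$. *)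

(* Defs.v *)
From HB Require Import structures.
From mathcomp Require Import all_boot all_order all_algebra.
From mathcomp Require Import all_classical all_reals all_analysis.
Set Implicit Arguments. Unset Strict Implicit. Unset Printing Implicit Defensive.
Import Order.TTheory GRing.Theory Num.Theory.
Import numFieldNormedType.Exports.
Local Open Scope classical_set_scope.
Local Open Scope ring_scope.

(* R^m is modelled as m.-tuple R (product sigma-algebra = Borel sigma-algebra)
   for measure theory, and as 'rV[R]_m (normed space) for differentiation. *)

Definition tup2row {R : Type} {m : nat} (t : m.-tuple R) : 'rV[R]_m :=
  \row_i tnth t i.
Definition row2tup {R : Type} {m : nat} (r : 'rV[R]_m) : m.-tuple R :=
  [tuple r ord0 i | i < m].

Definition relu {R : realDomainType} (x : R) : R := Num.max x 0.

Inductive relu_net (R : realDomainType) : nat -> Type :=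
| OutLayer n (w : 'rV[R]_n) (b : R) : relu_net R n
| Hidden n k (W : 'M[R]_(k, n)) (b : 'cV[R]_k) (rest : relu_net R k) : relu_net R n.

Fixpoint net_eval (R : realDomainType) n (N : relu_net R n) : 'cV[R]_n -> R :=
  match N in relu_net _ n return 'cV[R]_n -> R with
  | OutLayer _ w b => fun x => (w *m x) ord0 ord0 + b
  | Hidden _ _ W b rest => fun x => net_eval rest (map_mx relu (W *m x + b))
  end.

Definition net_fun (R : realType) m (N : relu_net R m) : 'rV[R]_m -> R :=
  fun x => net_eval N x^T.

(* gradient of u where u is (Frechet) differentiable; the value 0 elsewhere
   is an arbitrary convention on a Lebesgue-null set *)
Definition grad (R : realType) m (u : 'rV[R]_m -> R) (x : 'rV[R]_m) : 'rV[R]_m :=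
  if `[< differentiable u x >] then \row_i ('d u x (delta_mx ord0 i)) else 0.

Definition net_grad (R : realType) m (N : relu_net R m) (t : m.-tuple R)
  : m.-tuple R := row2tup (grad (net_fun N) (tup2row t)).

Definition sqdist (R : realType) m (z : m.-tuple R * m.-tuple R) : R :=
  \sum_(i < m) (tnth z.1 i - tnth z.2 i) ^+ 2.

Definition coupling (R : realType) m (P Q : set (m.-tuple R) -> \bar R)
  (g : probability (m.-tuple R * m.-tuple R)%type R) : Prop :=
  (forall A : set (m.-tuple R), measurable A -> g (A `*` setT) = P A) /\
  (forall B : set (m.-tuple R), measurable B -> g (setT `*` B) = Q B).

Definition W2sq (R : realType) m (P Q : set (m.-tuple R) -> \bar R) : \bar R :=
  ereal_inf [set c | exists g : probability (m.-tuple R * m.-tuple R)%type R,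
     coupling P Q g /\ c = (\int[g]_z (sqdist z)%:E)%E].

Definition posdef (R : realType) m (S : 'M[R]_m) : Prop :=
  S^T = S /\ forall v : 'rV[R]_m, v != 0 -> 0 < (v *m S *m v^T) ord0 ord0.

Definition gaussian (R : realType) m (mu : 'rV[R]_m) (S : 'M[R]_m)
  (G : probability (m.-tuple R) R) : Prop :=
  forall a : 'rV[R]_m, a != 0 ->
  forall A : set R, measurable A ->
    pushforward G (fun x : m.-tuple R => \sum_(i < m) a ord0 i * tnth x i) A
    = normal_prob ((a *m mu^T) ord0 ord0) (Num.sqrt ((a *m S *m a^T) ord0 ord0)) A.

(* Main.v *)
Require Import Defs.
From HB Require Import structures.
From mathcomp Require Import all_boot all_order all_algebra.
From mathcomp Require Import all_classical all_reals all_analysis.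
From mathcomp Require Import measurable_realfun ring lra.
Set Implicit Arguments. Unset Strict Implicit. Unset Printing Implicit Defensive.
Import Order.TTheory GRing.Theory Num.Theory.
Import numFieldNormedType.Exports.
Local Open Scope classical_set_scope.
Local Open Scope ring_scope.

(* Semi-discrete transport.  Cut the support of P into small boxes Q_i of
   positive mass p_i, with corners y_i, and take u = max_i (y_i . x + h_i),
   which a ReLU network computes exactly.  Its gradient is y_i on the open cell
   where the i-th affine piece dominates, so only the Gaussian masses of the
   cells matter.  Fix h_{i0} = 0, restrict the other heights to a fine lattice
   and maximise their sum subject to G(cell_i) <= p_i for i <> i0.  Raising one
   more h_i shrinks all the other cells and enlarges cell_i only by slabs, of
   small mass because the one-dimensional marginals of G have bounded densities;
   by maximality the mass of cell_i is then close to p_i.  The coupling sends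
   the part of Q_i that fits to y_i and the small excess to y_{i0}. *)

(** * Maxima of affine functions as ReLU networks *)

Definition aff (R : realDomainType) n (c : 'rV[R]_n * R) (z : 'cV[R]_n) : R :=
  (c.1 *m z) ord0 ord0 + c.2.

Lemma relu_subN (R : realDomainType) (x : R) : relu x - relu (- x) = x.
Proof.
rewrite /relu /Num.max; by case: (ltP x 0); case: (ltP (- x) 0); lra.
Qed.

(* One hidden layer turns the maximum of k+1 affine functions into that of k: it
   outputs [relu (a z - b z)], [z^+] and [z^-], and
   [max (a z) (b z) = relu (a z - b z) + b (z^+ - z^-)]. *)
Lemma relu_net_max (R : realType) n (a : 'rV[R]_n * R) (s : seq ('rV[R]_n * R)) :
  exists N : relu_net R n, forall z : 'cV[R]_n,
    (exists2 c, c \in a :: s & net_eval N z = aff c z) /\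
    (forall c, c \in a :: s -> aff c z <= net_eval N z).
Proof.
(* The input dimension [n] stays general in the induction, because the rest of the network reads the
   [1 + (n + n)] hidden units. *)
move sk : (size s) => k; elim: k n a s sk => [|k IH] n a.
  move=> s /size0nil ->; exists (OutLayer a.1 a.2) => z; split=> [|c]; first by exists a; rewrite ?mem_head.
  by rewrite inE => /eqP ->.
move=> [//|b s] [sk].
pose lift (c : 'rV[R]_n * R) : 'rV[R]_(1 + (n + n)) * R :=
  (row_mx 0 (row_mx c.1 (- c.1)), c.2).
have [N' HN'] := IH (1 + (n + n))%N
   (row_mx 1%:M (row_mx b.1 (- b.1)), b.2) (map lift s) (etrans (size_map _ _) sk).
exists (@Hidden _ n (1 + (n + n)) (col_mx (a.1 - b.1) (col_mx 1%:M (- 1%:M)))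
  (col_mx (const_mx (a.2 - b.2)) 0) N') => z /=.
set hz := map_mx relu _.
have hzE : hz = col_mx (const_mx (relu (aff a z - aff b z)))
    (col_mx (map_mx relu z) (map_mx relu (- z))).
  rewrite /hz !mul_col_mx add_col_mx !map_col_mx addr0 mul1mx mulNmx mul1mx map_col_mx.
  congr (col_mx _ _); apply/matrixP => i j; rewrite mulmxBl !ord1 !mxE /aff.
  by congr relu; rewrite !mxE; ring.
have zE : map_mx relu z - map_mx relu (- z) = z.
  by apply/matrixP => i j; rewrite !mxE relu_subN.
have liftE c : aff (lift c) hz = aff c z.
  by rewrite /aff /= hzE !mul_row_col mul0mx add0r mulNmx -mulmxBr zE.
have headE : aff (row_mx 1%:M (row_mx b.1 (- b.1)), b.2) hz =
    Num.max (aff a z) (aff b z).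
  rewrite {1}/aff /= hzE !mul_row_col mul1mx mulNmx -mulmxBr zE.
  by rewrite [(_ + _ *m _) _ _]mxE [const_mx _ _ _]mxE -addrA -[_ + b.2]/(aff b z) /relu addr_maxl subrK add0r.
move: (HN' hz) => [[c' c's Hc'] Hle]; split.
  move: c's; rewrite inE => /orP[/eqP c'E|/mapP[c cs c'E]]; last first.
    by exists c; rewrite ?inE ?cs ?orbT// Hc' c'E liftE.
  have [ab|ba] := leP (aff a z) (aff b z).
    by exists b; rewrite ?inE ?eqxx ?orbT// Hc' c'E headE (elimT max_idPr ab).
  by exists a; rewrite ?inE ?eqxx// Hc' c'E headE (elimT max_idPl (ltW ba)).
have := Hle _ (mem_head _ _); rewrite headE ge_max => /andP[ha hb] c.
rewrite !inE => /or3P[/eqP ->|/eqP ->|cs] //.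
by rewrite -liftE; apply: Hle; rewrite inE map_f ?orbT.
Qed.

(** * Differentials of a function that touches an affine minorant *)

Section gradient.
Context {R : realType} {m : nat}.
Implicit Types (u f g : 'rV[R]_m -> R) (x v w : 'rV[R]_m) (c : 'rV[R]_m * R).

Definition dotr w v : R := (w *m v^T) ord0 ord0.

Lemma dotrE w v : dotr w v = \sum_(i < m) w ord0 i * v ord0 i.
Proof. by rewrite /dotr mxE; apply: eq_bigr => i _; rewrite mxE. Qed.

Lemma dotr_is_linear w : linear (dotr w : 'rV[R]_m -> R^o).
Proof. by move=> k v1 v2; rewrite /dotr linearP/= mulmxDr -scalemxAr !mxE. Qed.

HB.instance Definition _ w :=
  GRing.isLinear.Build R 'rV[R]_m R^o _ (dotr w) (dotr_is_linear w).

Lemma dotr_continuous w : continuous (dotr w).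
Proof.
move=> x; rewrite (_ : dotr w = \sum_(i < m) (fun v : 'rV[R]_m => w ord0 i * v ord0 i)).
  apply: differentiable_continuous; apply: differentiable_sum => i.
  by apply: differentiableM => //; exact: differentiable_coord.
by apply/funext => v; rewrite dotrE fct_sumE.
Qed.


(** The first-order expansion at [x] only sees values near [x], and a continuous linear map
    satisfying it is unique. This serves to differentiate the network where a single piece is active
    around a point. *)
Lemma near_eq_diff (V W : normedModType R) (f g : V -> W) (x : V) :
  {near x, f =1 g} -> differentiable g x ->
  differentiable f x /\ 'd f x = 'd g x :> (V -> W).
Proof.
move=> fg dg; have fgx := nbhs_singleton fg.
have fE : f \o shift x = cst (f x) + 'd g x +o_ 0 id.
  apply/eqaddoP => e e0.
  have /diff_locally/eqaddoP/(_ e e0) := dg.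
  have : \forall h \near (0 : V), f (h + x) = g (h + x).
    move: fg; rewrite (near_shift 0 x)/=; apply: filterS => h.
    by rewrite /= subr0.
  by apply: filterS2 => h fgh; rewrite /= !fctE /= fgh fgx.
have dE : 'd f x = 'd g x :> (V -> W).
  by apply: diff_unique fE; exact: diff_continuous.
split=> //; apply/diff_locallyP; rewrite dE; split=> //.
exact: diff_continuous.
Qed.

Lemma diff_aff c x : differentiable (fun v => aff c v^T) x /\
  'd (fun v => aff c v^T) x = dotr c.1 :> (_ -> _).
Proof.
have dl := linear_differentiable x (@dotr_continuous c.1).
have -> : (fun v => aff c v^T) = dotr c.1 \+ cst c.2 by [].
have dc : differentiable (cst c.2 : 'rV[R]_m -> R) x by exact: differentiable_cst.
split; first exact: differentiableD.
rewrite (diffD dl dc) (diff_lin x (@dotr_continuous c.1)) diff_cst.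
by apply/funext => v /=; rewrite addr0.
Qed.

Lemma derive_at_min (f : 'rV[R]_m -> R) x v :
  (forall z, f x <= f z) -> differentiable f x -> 0 <= 'd f x v.
Proof.
move=> fmin df; rewrite -deriveE//.
have fd : derivable f x v by exact: diff_derivable.
(* At a minimum the difference quotient has a known sign for [h > 0], so the derivative is computed
   as a limit from the right. *)
rewrite ['D_v f x]cvg_at_rightE//; apply: limr_ge.
  rewrite -(cvg_at_rightE (fun h : R => h^-1 *: ((f \o shift x) _ - f x))) //.
  apply: cvg_trans fd; apply: cvg_app.
  move=> A [e egt0 Ae]; exists e => // z xe xgt0; apply: Ae => //.
  exact/lt0r_neq0.
near=> h; apply: mulr_ge0.
  by rewrite invr_ge0; apply: ltW; near: h; exists 1 => /=.
by rewrite subr_ge0; apply: fmin.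
Unshelve. all: by end_near. Qed.

(* [u] minus the affine piece has a minimum at [x]. *)
Lemma diff_active (u : 'rV[R]_m -> R) c x : (forall z, aff c z^T <= u z) ->
  u x = aff c x^T -> differentiable u x -> 'd u x = dotr c.1 :> (_ -> _).
Proof.
move=> cu uxE du; have [dc dcE] := diff_aff c x.
pose f := u \- (fun z => aff c z^T).
have df : differentiable f x by exact: differentiableB.
have fmin z : f x <= f z by rewrite /f /= uxE subrr subr_ge0.
have dfE v : 'd f x v = 'd u x v - dotr c.1 v.
  by rewrite (diffB du dc) /= dcE.
apply/funext => v; apply/eqP; rewrite -subr_eq0 -dfE eq_le.
(* A linear form that is nonnegative at both [v] and [- v] vanishes at [v]. *)
rewrite derive_at_min// andbT -oppr_ge0 -linearN.
exact: derive_at_min.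
Qed.

End gradient.

(** * Cells of a maximum of affine functions, and its gradient on them *)

Section cells.
Context {R : realType} {m : nat} {I : finType}.
Variables (y : I -> 'rV[R]_m) (h : I -> R).

Definition height (i : I) (t : m.-tuple R) : R := dotr (y i) (tup2row t) + h i.

(** Open Laguerre cells of semi-discrete transport: the inequalities are strict, so a point where
    the top height is tied lies in no cell. *)
Definition cell (i : I) : set (m.-tuple R) :=
  [set t | forall j, j != i -> height j t < height i t].

Lemma dotr_delta (w : 'rV[R]_m) i : dotr w (delta_mx ord0 i) = w ord0 i.
Proof.
rewrite dotrE (bigD1 i)//= mxE !eqxx mulr1 big1 ?addr0// => j ji.
by rewrite mxE (negbTE ji) mulr0.
Qed.

(* Off the cells two pieces with distinct slopes are active, so [u] is not
   differentiable and [grad] takes its junk value 0; knowing this value gives the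
   measurability of [net_grad N] on all of R^m, not only almost everywhere. *)
Lemma net_grad_cell (i0 : I) : injective y -> exists N : relu_net R m,
  (forall i t, cell i t -> net_grad N t = row2tup (y i)) /\
  (forall t, (forall i, ~ cell i t) -> net_grad N t = row2tup 0).
Proof.
move=> yI.
have [N HN] := relu_net_max (y i0, h i0) [seq (y i, h i) | i <- enum I].
exists N.
have mem i : (y i, h i) \in (y i0, h i0) :: [seq (y i, h i) | i <- enum I].
  by rewrite inE; apply/orP; right; apply/mapP; exists i; rewrite ?mem_enum.
have netge i x : aff (y i, h i) x^T <= net_fun N x.
  by rewrite /net_fun; apply: (HN _).2.
have netex x : exists i, net_fun N x = aff (y i, h i) x^T.
  have [[c + cE] _] := HN x^T; rewrite inE => /orP[/eqP cE0|/mapP[i _ ciE]].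
    by exists i0; rewrite -cE0.
  by exists i; rewrite -ciE.
have gradE i x : net_fun N x = aff (y i, h i) x^T ->
    differentiable (net_fun N) x -> grad (net_fun N) x = y i.
  move=> xi dx; rewrite /grad asboolT//; apply/rowP => j.
  by rewrite mxE (diff_active (netge i) xi dx) dotr_delta.
split=> [i t it|t tN]; rewrite /net_grad; congr row2tup.
  have xE z : (forall j, j != i -> aff (y j, h j) z^T < aff (y i, h i) z^T) ->
      net_fun N z = aff (y i, h i) z^T.
    move=> Hz; have [j zj] := netex z; have [<-//|/Hz ji] := eqVneq j i.
    by have := netge i z; rewrite zj leNgt ji.
  (* Finitely many strict inequalities between continuous functions persist on a neighbourhood,
     where the network is therefore the [i]-th piece. *)
  have nearE : {near tup2row t, net_fun N =1 fun z => aff (y i, h i) z^T}.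
    have H j : \forall z \near tup2row t, j != i ->
        aff (y j, h j) z^T < aff (y i, h i) z^T.
      have [->|ji] := eqVneq j i; first by near=> z.
      have : {for tup2row t, continuous (fun z : 'rV[R]_m =>
          aff (y i, h i) z^T - aff (y j, h j) z^T)}.
        apply: differentiable_continuous.
        by apply: differentiableB; apply: (diff_aff _ _).1.
      move=> /cvgrPdist_lt cont.
      have ij0 : 0 < aff (y i, h i) (tup2row t)^T - aff (y j, h j) (tup2row t)^T.
        by rewrite subr_gt0; exact: it.
      move: {cont}(cont _ ij0); apply: filterS => z; rewrite ltr_norml => /andP[_].
      by rewrite ltrBlDr ltrDl subr_gt0.
    have HH := @filter_forall _ I (fun j z => j != i ->
        aff (y j, h j) z^T < aff (y i, h i) z^T) (nbhs (tup2row t)) _ H.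
    by near=> z; apply: xE; near: z; exact: HH.
  apply: gradE; first exact: nbhs_singleton nearE.
  exact: (near_eq_diff nearE (diff_aff _ _).1).1.
rewrite /grad; case: asboolP => // dx; exfalso.
(* If the network were differentiable here, a second piece tied with the active one would have the
   gradient as its slope too, against the injectivity of [y]; so [t] would lie in the cell of
   [i]. *)
have [i xi] := netex (tup2row t).
apply: (tN i) => j ji; rewrite lt_neqAle; apply/andP; split; last first.
  by rewrite /height -[leRHS]/(aff (y i, h i) (tup2row t)^T) -xi netge.
apply/eqP => E; have xj : net_fun N (tup2row t) = aff (y j, h j) (tup2row t)^T.
  by rewrite xi; exact: (esym E).
by move/eqP: ji; apply; apply: yI; rewrite -(gradE _ _ xi dx) -(gradE _ _ xj dx).
Unshelve. all: by end_near. Qed.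

End cells.

(** * Gaussian mass of slabs, and tails *)

Section gaussian_measure.
Context {R : realType} {m : nat}.
Implicit Types (G : probability (m.-tuple R) R) (a : 'rV[R]_m).

Lemma measurable_dotr a :
  measurable_fun [set: m.-tuple R] (fun t => dotr a (tup2row t)).
Proof.
under eq_fun do rewrite dotrE.
apply: measurable_sum => i; apply: measurable_funM => //.
under eq_fun do rewrite mxE.
exact: measurable_tnth.
Qed.

(** The marginal along [a] is normal with variance [a S a^T > 0], so its density is bounded by its
    peak, which serves as [C]. *)
Lemma gaussian_slab (mu : 'rV[R]_m) (S : 'M[R]_m) G a :
  posdef S -> gaussian mu S G -> a != 0 ->
  exists2 C : R, 0 <= C & forall c d : R, 0 <= d ->
    (G [set t | (c <= dotr a (tup2row t) <= c + d)%R] <= (C * d)%:E)%E.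
Proof.
move=> [_ pS] hG a0; have s0 := pS _ a0.
set s := Num.sqrt ((a *m S *m a^T) ord0 ord0).
have sn0 : s != 0 by rewrite gt_eqF// sqrtr_gt0.
exists (normal_peak s); first exact: normal_peak_ge0.
move=> c d d0; have := hG a a0 `[c, c + d]%classic (measurable_itv _).
rewrite /pushforward -/s.
rewrite (_ : _ @^-1` _ = [set t | c <= dotr a (tup2row t) <= c + d]); last first.
  apply/funext => t; rewrite /preimage /= in_itv/= dotrE.
  by under [in RHS]eq_bigr do rewrite mxE.
move=> ->; rewrite /normal_prob.
apply: (@le_trans _ _ (\int[lebesgue_measure]_(x in `[c, (c + d)%R]) (normal_peak s)%:E)%E).
  apply: ge0_le_integral => //=.
  - by move=> x _; rewrite lee_fin normal_pdf_ge0.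
  - by apply/measurable_EFinP; apply: measurable_funTS; exact: measurable_normal_pdf.
  - by move=> x _; rewrite lee_fin normal_pdf_ub.
rewrite integral_cst//= lebesgue_measure_itv/= lte_fin.
case: ifPn => [_|]; first by rewrite -EFinB -EFinM addrAC subrr add0r.
by rewrite mule0 lee_fin mulr_ge0// normal_peak_ge0.
Qed.

(** Continuity from above: the sets where [n <= f] decrease to the empty set. *)
Lemma probability_tail d (T : measurableType d) (P : probability T R)
    (f : T -> R) (e : R) : measurable_fun setT f -> 0 < e ->
  exists K : nat, (P [set t | (K%:R <= f t)%R] < e%:E)%E.
Proof.
move=> mf e0.
have mF n : measurable [set t | n%:R <= f t].
  by have := mf measurableT `[n%:R, +oo[%classic (measurable_itv _);
    rewrite setTI set_itvE.
have I0 : \bigcap_n [set t | n%:R <= f t] = set0.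
  rewrite -subset0 => t /= /(_ (Num.bound `|f t|) Logic.I) /=; rewrite leNgt => /negP; apply.
  exact: le_lt_trans (ler_norm _) (archi_boundP (normr_ge0 _)).
have cvg : (P \o (fun n => [set t | n%:R <= f t])) @ \oo --> P (\bigcap_n [set t | n%:R <= f t]).
  apply: nonincreasing_cvg_mu => //.
  - by rewrite (le_lt_trans (probability_le1 _ _))// ltry.
  - by rewrite I0.
  - move=> n k nk; apply/subsetPset => t /=; apply: le_trans; by rewrite ler_nat.
rewrite I0 measure0 in cvg.
have /cvg[K _ HK] : nbhs 0%E [set x | (x < e%:E)%E] by exact: open_ereal_lt'.
by exists K; apply: HK => /=.
Qed.

End gaussian_measure.

(** * Real-valued probabilities of finite families of sets *)

Lemma fsum_finType (R : realType) (I : finType) (F : I -> \bar R) :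
  (\sum_(i \in [set: I]) F i = \sum_i F i)%E.
Proof.
have -> : [set: I] = [set` enum I].
  by apply/seteqP; split=> i //= _; rewrite mem_enum.
by rewrite -fsbig_seq ?enum_uniq// big_enum.
Qed.

Section fine_probability.
Context d (T : measurableType d) (R : realType) (P : probability T R).

Lemma prob_fin_num (A : set T) : measurable A -> P A \is a fin_num.
Proof. by move=> mA; exact: fin_num_measure. Qed.

Lemma fine_prob_le (A B : set T) : measurable A -> measurable B ->
  A `<=` B -> fine (P A) <= fine (P B).
Proof.
by move=> mA mB AB; rewrite fine_le ?prob_fin_num// le_measure ?inE.
Qed.

Lemma fine_prob_cover (I : finType) (A : set T) (F : I -> set T) :
  measurable A -> (forall i, measurable (F i)) -> A `<=` \bigcup_i F i ->
  fine (P A) <= \sum_i fine (P (F i)).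
Proof.
move=> mA mF AF; rewrite -lee_fin fineK ?prob_fin_num// -sumEFin.
under eq_bigr do rewrite fineK ?prob_fin_num//.
have := content_sub_fsum P (@finite_finset I setT) (fun i _ => mF i) mA AF.
by rewrite fsum_finType.
Qed.

Lemma fine_prob_partition (I : finType) (F : I -> set T) :
  (forall i, measurable (F i)) -> trivIset setT F ->
  fine (P (\bigcup_i F i)) = \sum_i fine (P (F i)).
Proof.
move=> mF tF; rewrite measure_fin_bigcup//; last exact: finite_finset.
rewrite fsum_finType (eq_bigr (fun i => (fine (P (F i)))%:E)) ?sumEFin// => i _.
by rewrite fineK ?prob_fin_num.
Qed.

End fine_probability.

(** * Heights whose cells have nearly prescribed Gaussian masses *)

Section balanced_cells.
Context {R : realType} {m : nat} {I : finType}.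
Variables (mu : 'rV[R]_m) (S : 'M[R]_m) (G : probability (m.-tuple R) R).
Hypotheses (pS : posdef S) (hG : gaussian mu S G).
Variables (y : I -> 'rV[R]_m) (yI : injective y).

Let mass (h : I -> R) (i : I) : R := fine (G (cell y h i)).

Lemma dotrBl (a b v : 'rV[R]_m) : dotr (a - b) v = dotr a v - dotr b v.
Proof. by rewrite /dotr mulmxBl !mxE. Qed.

Lemma heightB h i j t : height y h i t - height y h j t =
  dotr (y i - y j) (tup2row t) + (h i - h j).
Proof. by rewrite dotrBl /height; ring. Qed.

Lemma measurable_dotr_slab (a : 'rV[R]_m) (J : interval R) :
  measurable [set t : m.-tuple R | dotr a (tup2row t) \in J].
Proof.
have := measurable_dotr a measurableT (measurable_itv J).
by rewrite setTI.
Qed.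

Lemma measurable_cell h i : measurable (cell y h i).
Proof.
rewrite (_ : cell y h i =
    \bigcap_(j in [set j | j != i]) [set t | dotr (y i - y j) (tup2row t) \in `]h j - h i, +oo[]).
  apply: fin_bigcap_measurable; first exact: finite_finset.
  by move=> j _; exact: measurable_dotr_slab.
apply/seteqP; split=> t H j /= ji.
  by rewrite in_itv/= andbT -subr_gt0 opprB -heightB subr_gt0 H.
by have := H j ji; rewrite /= in_itv/= andbT -subr_gt0 opprB -heightB subr_gt0.
Qed.

Lemma cell_disjoint h : trivIset setT (cell y h).
Proof.
apply/trivIsetP => i j _ _ ij; rewrite -subset0 => t [ti tj].
have := ti j; rewrite eq_sym ij => /(_ isT).
by rewrite ltNge => /negP; apply; apply: ltW; apply: tj.
Qed.

(** One table of constants, independent of position and width, for all pairs of slopes. On the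
    diagonal the direction is zero, no bound is claimed and the entry is 0. *)
Lemma slab_bound : exists C : I -> I -> R, forall i j, 0 <= C i j /\
  (i != j -> forall c d, 0 <= d ->
   fine (G [set t | dotr (y i - y j) (tup2row t) \in `[c, c + d]]) <= C i j * d).
Proof.
suff /choice[C HC] : forall ij : I * I, exists C : R, 0 <= C /\
    (ij.1 != ij.2 -> forall c d, 0 <= d ->
     fine (G [set t | dotr (y ij.1 - y ij.2) (tup2row t) \in `[c, c + d]]) <= C * d).
  by exists (fun i j => C (i, j)) => i j; exact: (HC (i, j)).
move=> [i j] /=; have [->|ij] := eqVneq i j; first by exists 0.
have a0 : y i - y j != 0 by rewrite subr_eq0; apply: contra_neq ij => /yI.
have [C C0 HC] := gaussian_slab pS hG a0.
exists C; split=> // _ c d d0; rewrite -lee_fin fineK.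
  by have := HC c d d0; congr (G _ <= _)%E; apply/seteqP; split=> t /=; rewrite in_itv.
by apply: prob_fin_num; exact: measurable_dotr_slab.
Qed.

(** A point outside all cells has two indices tied for the top height. It then lies on a hyperplane,
    which is a slab of width 0 and hence null. *)
Lemma mass_sum (i0 : I) h : \sum_i mass h i = 1.
Proof.
have mU : measurable (\bigcup_i cell y h i).
  by apply: fin_bigcup_measurable => [|i _]; [exact: finite_finset|exact: measurable_cell].
rewrite /mass -fine_prob_partition; [|exact: measurable_cell|exact: cell_disjoint].
suff N0 : fine (G (~` \bigcup_i cell y h i)) <= 0.
  have := probability_setC G mU.
  have : (0 <= G (~` \bigcup_i cell y h i))%E by [].
  have := prob_fin_num G (measurableC mU); have := prob_fin_num G mU.
  move: N0; case: (G (~` _)) => //= r r0; case: (G _) => //= s _ _.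
  by rewrite lee_fin => r1; rewrite -EFinB => -[]; lra.
have [C HC] := slab_bound.
pose tie (ij : I * I) := if ij.1 == ij.2 then set0 else
  [set t | dotr (y ij.1 - y ij.2) (tup2row t) \in `[h ij.2 - h ij.1, h ij.2 - h ij.1 + 0]].
have mtie ij : measurable (tie ij).
  by rewrite /tie; case: ifP => // _; exact: measurable_dotr_slab.
apply: (@le_trans _ _ (\sum_ij fine (G (tie ij)))); last first.
  apply: sumr_le0 => -[i j] _; rewrite /tie/=; case: ifPn => [_|ij].
    by rewrite measure0.
  by rewrite (le_trans ((HC i j).2 ij _ _ (lexx _)))// mulr0.
apply: fine_prob_cover => //; first exact: measurableC.
move=> t tN.
have [i _ imax] : exists2 i, true & forall j, height y h j t <= height y h i t.
  by case: (@arg_maxP _ _ _ i0 xpredT (fun i => height y h i t)) => // i _ H; exists i => // j; exact: H.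
have [j ji tij] : exists2 j, j != i & height y h j t = height y h i t.
  apply/not_exists2P => H; apply: tN; exists i => // j ji.
  by rewrite lt_neqAle imax andbT; apply/eqP => e; case: (H j).
exists (i, j) => //; rewrite /tie /= eq_sym (negbTE ji)/= in_itv/= addr0.
have := heightB h i j t; rewrite tij subrr => /esym/eqP.
rewrite addr_eq0 opprB => /eqP ->; by rewrite lexx.
Qed.

(** A point gained by cell [i] was losing to some [j] by at most [d], so it lies in a slab of width
    [d] in the direction [y i - y j]. The other cells only meet a stronger competitor. *)
Lemma mass_raise h h' i d (C : I -> I -> R) : 0 <= d ->
  (forall i j, 0 <= C i j /\ (i != j -> forall c d, 0 <= d ->
   fine (G [set t | dotr (y i - y j) (tup2row t) \in `[c, c + d]]) <= C i j * d)) ->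
  h' i = h i + d -> (forall j, j != i -> h' j = h j) ->
  mass h' i <= mass h i + (\sum_i \sum_j C i j) * d /\
  (forall j, j != i -> mass h' j <= mass h j).
Proof.
move=> d0 HC h'i h'j; split; last first.
  move=> j ji; apply: fine_prob_le; [exact: measurable_cell|exact: measurable_cell|].
  move=> t tj k kj; have := tj k kj; rewrite /height (h'j _ ji).
  have [->|ki] := eqVneq k i; last by rewrite (h'j _ ki).
  by rewrite h'i; lra.
(* The index [i], which needs no slab, carries the old cell, so that one family over [I] covers the
   new cell. *)
pose slab (j : I) := if j == i then cell y h i else
  [set t | dotr (y i - y j) (tup2row t) \in `[h j - h i - d, h j - h i - d + d]].
apply: (@le_trans _ _ (\sum_j fine (G (slab j)))).
  apply: fine_prob_cover; first exact: measurable_cell.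
    move=> j; rewrite /slab; case: ifP => _; first exact: measurable_cell.
    exact: measurable_dotr_slab.
  move=> t ti; have [it|] := pselect (cell y h i t).
    by exists i; rewrite // /slab eqxx.
  move=> /existsNP[j /not_implyP[ji /negP]]; rewrite -leNgt => hij.
  exists j => //=; rewrite /slab (negbTE ji)/= in_itv/=.
  have := ti j ji; move: hij; rewrite /height dotrBl h'i (h'j _ ji).
  by move=> *; apply/andP; split; lra.
have C0 k : 0 <= \sum_j C k j by apply: sumr_ge0 => j _; exact: (HC _ _).1.
rewrite (bigD1 i)//= {1}/slab eqxx lerD2l.
rewrite (@le_trans _ _ ((\sum_j C i j) * d))//; last first.
  by rewrite ler_wpM2r// [leRHS](bigD1 i)//= lerDl sumr_ge0.
rewrite mulr_suml [leRHS](bigD1 i)//= ler_wpDl//.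
  by rewrite mulr_ge0//; exact: (HC _ _).1.
apply: ler_sum => j ji; rewrite /slab (negbTE ji).
by apply: (HC i j).2 => //; rewrite eq_sym.
Qed.

Lemma balanced_heights (i0 : I) (p : I -> R) (e : R) :
  (forall i, 0 < p i) -> \sum_i p i = 1 -> 0 < e ->
  exists h : I -> R, forall i, i != i0 -> p i - e <= mass h i <= p i.
Proof.
move=> p0 p1 e0; have [C HC] := slab_bound.
set Ct := \sum_i \sum_j C i j.
have Ct0 : 0 <= Ct.
  by apply: sumr_ge0 => k _; apply: sumr_ge0 => j _; exact: (HC _ _).1.
(* Lattice step: raising one height by [d] adds at most [Ct * d <= e] to the mass of its cell. The
   [+ 1] keeps the denominator positive. *)
pose d := e / (Ct + 1).
have d0 : 0 < d by rewrite divr_gt0//; lra.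
have Cd : Ct * d <= e.
  by rewrite /d mulrA ler_pdivrMr; [rewrite mulrDr mulr1 mulrC; lra|lra].
have tail a q : 0 < q -> exists K : nat,
    fine (G [set t : m.-tuple R | dotr a (tup2row t) \in `[K%:R, +oo[]) < q.
  move=> q0; have [K HK] := probability_tail G (measurable_dotr a) q0.
  exists K; rewrite -lte_fin fineK ?prob_fin_num//; last exact: measurable_dotr_slab.
  move: HK; congr (G _ < _)%E; apply/seteqP; split=> t /=;
  by rewrite in_itv/= andbT.
(* Starting heights [- K i], low enough for cell [i] to have mass below [p i]. *)
have /choice[K HK] : forall i, exists K : nat,
    fine (G [set t : m.-tuple R | dotr (y i - y i0) (tup2row t) \in `[K%:R, +oo[]) < p i.
  by move=> i; exact: tail.
(* Ceilings: a height above [L i] would leave cell [i0] with mass below [p i0]. *)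
have /choice[L HL] : forall i, exists K : nat,
    fine (G [set t : m.-tuple R | dotr (y i0 - y i) (tup2row t) \in `[K%:R, +oo[]) < p i0.
  by move=> i; exact: tail.
pose h (k : {ffun I -> nat}) (i : I) : R :=
  if i == i0 then 0 else d * (k i)%:R - (K i)%:R.
(* The heights do not depend on [k i0]; pinning it to 0 keeps the sums of admissible [k] bounded. *)
pose adm (k : {ffun I -> nat}) :=
  k i0 = 0%N /\ forall i, i != i0 -> mass (h k) i <= p i.
pose Q n := `[< exists2 k, adm k & (\sum_i k i = n)%N >].
have Qex : exists n, Q n.
  exists 0%N; apply/asboolP; exists [ffun => 0%N]; last first.
    by rewrite big1// => i _; rewrite ffunE.
  split=> [|i ii0]; first by rewrite ffunE.
  apply: le_trans (ltW (HK i)); apply: fine_prob_le; first exact: measurable_cell.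
    exact: measurable_dotr_slab.
  move=> t /(_ i0); rewrite eq_sym => /(_ ii0).
  rewrite -subr_gt0 heightB /h eqxx (negbTE ii0) ffunE mulr0 /= in_itv/= andbT.
  by lra.
pose B i := Num.bound (((K i)%:R + (L i)%:R) / d).
have Qub n : Q n -> (n <= \sum_i B i)%N.
  move=> /asboolP[k [ki0 adk] <-]; apply: leq_sum => i _.
  have [->|ii0] := eqVneq i i0; first by rewrite ki0.
  have hL : h k i <= (L i)%:R.
    rewrite leNgt; apply/negP => Lh; have := HL i; apply/negP; rewrite -leNgt.
    (* The masses sum to 1, as do the [p i], and the other cells are at most their targets, so cell
       [i0] has mass at least [p i0]. *)
    apply: (@le_trans _ _ (mass (h k) i0)).
      have := mass_sum i0 (h k); rewrite (bigD1 i0)//=.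
      have : \sum_(j | j != i0) mass (h k) j <= \sum_(j | j != i0) p j.
        by apply: ler_sum => j; exact: adk.
      by move: p1; rewrite (bigD1 i0)//=; lra.
    apply: fine_prob_le; first exact: measurable_cell.
      exact: measurable_dotr_slab.
    move=> t /(_ i ii0); rewrite -subr_gt0 heightB /= in_itv/= andbT.
    by rewrite {1}/h eqxx; lra.
  have kd : (k i)%:R * d <= (K i)%:R + (L i)%:R.
    by move: hL; rewrite /h (negbTE ii0); lra.
  rewrite -(ler_nat R); move: kd; rewrite -ler_pdivlMr// => /le_trans; apply.
  apply: ltW; apply: archi_boundP.
  by apply: divr_ge0; [exact: addr_ge0|exact: ltW].
case: (ex_maxnP Qex Qub) => n /asboolP[k [ki0 adk] kn] nmax.
exists (h k) => i ii0; rewrite adk// andbT leNgt; apply/negP => small.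
(* If cell [i] fell short by more than [e], one more lattice step at [i] would remain admissible,
   against maximality of the sum. *)
pose k' : {ffun I -> nat} := [ffun j => if j == i then (k j).+1 else k j].
have h'i : h k' i = h k i + d.
  by rewrite /h (negbTE ii0) ffunE eqxx -addn1 natrD; ring.
have h'j j : j != i -> h k' j = h k j by move=> ji; rewrite /h ffunE (negbTE ji).
have [mi mj] := mass_raise (ltW d0) HC h'i h'j.
have : Q n.+1.
  apply/asboolP; exists k'.
    split=> [|j ji0]; first by rewrite ffunE eq_sym (negbTE ii0).
    have [->|ji] := eqVneq j i; last exact: le_trans (mj _ ji) (adk _ ji0).
    by apply: (le_trans mi); rewrite -/Ct; lra.
  rewrite (bigD1 i)//= ffunE eqxx addSn -kn [in RHS](bigD1 i)//=.
  by congr (_ + _).+1; apply: eq_bigr => j ji; rewrite ffunE (negbTE ji).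
by move=> /nmax; rewrite ltnn.
Qed.

End balanced_cells.

(** * Couplings that send finitely many weighted pieces of [P] to points *)

Section coupling.
Context {R : realType} {m : nat}.
Notation T := (m.-tuple R).
Variables (P : probability T R).

Lemma sqdist_ge0 (z : T * T) : 0 <= sqdist z.
Proof. by apply: sumr_ge0 => i _; exact: sqr_ge0. Qed.

Lemma measurable_sqdist : measurable_fun setT (@sqdist R m).
Proof.
apply: measurable_sum => i; apply: measurable_funX; apply: measurable_funB.
  by apply: (measurableT_comp (measurable_tnth i)); exact: measurable_fst.
by apply: (measurableT_comp (measurable_tnth i)); exact: measurable_snd.
Qed.

Lemma big_ord_enum (K : finType) (k0 : K) (F : K -> \bar R) :
  (\sum_(n < #|K|) F (nth k0 (enum K) n) = \sum_k F k)%E.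
Proof.
rewrite -(big_mkord xpredT (fun n => F (nth k0 (enum K) n))) cardE.
by rewrite -(big_nth k0 xpredT F) big_enum.
Qed.

Variables (K : finType) (k0 : K) (Q : K -> set T) (mQ : forall k, measurable (Q k)).
Variables (w : K -> R) (w0 : forall k, 0 <= w k) (z : K -> T).

Let pairz (k : K) (x : T) : T * T := (x, z k).

Let measurable_pairz k : measurable_fun setT (pairz k).
Proof. by apply: measurable_fun_pair => //; exact: measurable_cst. Qed.

Let pushed (k : K) : {measure set (T * T) -> \bar R}.
Proof.
unshelve refine (pushforward (mrestr P (mQ k)) (pairz k) : {measure set _ -> \bar R}).
exact: measurable_pairz.
Defined.

Let piece k := mscale (NngNum (w0 k)) (pushed k).

(** The fraction [w k] of [P] restricted to [Q k] is sent to [z k]. The measures are summed along an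
    enumeration of [K], with [k0] as the default of [nth]. *)
Let plan := msum (fun n => piece (nth k0 (enum K) n)) #|K|.

Let planE A : plan A = (\sum_k (w k)%:E * P (pairz k @^-1` A `&` Q k))%E.
Proof. by rewrite /plan /msum (big_ord_enum k0 (fun k => piece k A)). Qed.

(** This makes [P] the first marginal. Disjoint [Q k] are not assumed: one set may occur under
    several indices, its mass being shared among several targets. *)
Hypothesis HP : forall A, measurable A ->
  \sum_k w k * fine (P (A `&` Q k)) = fine (P A).

Let planE1 A : measurable A -> plan (A `*` setT) = P A.
Proof.
move=> mA; rewrite planE -[RHS]fineK ?prob_fin_num// -HP// -sumEFin.
apply: eq_bigr => k _; rewrite EFinM fineK; last first.
  by apply: prob_fin_num; exact: measurableI.
by congr (_ * P (_ `&` _))%E; apply/seteqP; split=> x //= [].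
Qed.

Let plan_setT : plan setT = 1%E.
Proof. by rewrite -setXTT planE1// probability_setT. Qed.

HB.instance Definition _ := Measure.copy plan (msum (fun n => piece (nth k0 (enum K) n)) #|K|).
HB.instance Definition _ := Measure_isProbability.Build _ _ _ plan plan_setT.

Lemma mixture_cost (nu : set T -> \bar R) (c : K -> R) :
  (forall k, 0 <= c k) ->
  (forall k x, Q k x -> sqdist (x, z k) <= c k) ->
  (forall B, measurable B ->
    nu B = (\sum_k w k * fine (P (Q k)) * \1_B (z k))%:E) ->
  (W2sq P nu <= (\sum_k w k * (c k * fine (P (Q k))))%:E)%E.
Proof.
move=> c0 Hc Hnu.
apply: (@le_trans _ _ (\int[plan]_x (sqdist x)%:E)%E).
  apply: ereal_inf_lbound; exists plan; split=> //; split=> [A|B] mB.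
    exact: planE1.
  rewrite Hnu//; apply: etrans (planE _) _; rewrite -sumEFin; apply: eq_bigr => k _.
  rewrite -mulrA EFinM; congr (_ * _)%E; rewrite indicE.
  have [zB|zB] := boolP (z k \in B).
    rewrite mulr1 fineK ?prob_fin_num//; congr (P _).
    by apply/seteqP; split=> x; [case|]; move=> //= Qx; split=> //; split=> //; exact: set_mem.
  rewrite mulr0; rewrite (_ : _ `&` _ = set0) ?measure0//.
  rewrite -subset0 => x /= [[_ /=]] zB'; move/negP: zB; case.
  exact: mem_set.
have mf : measurable_fun setT (fun x : T * T => (sqdist x)%:E).
  by apply/measurable_EFinP; exact: measurable_sqdist.
rewrite ge0_integral_measure_sum//; last by move=> x _; rewrite lee_fin sqdist_ge0.
rewrite (big_ord_enum k0 (fun k => \int[piece k]_x (sqdist x)%:E)%E) -sumEFin.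
apply: lee_sum => k _; rewrite ge0_integral_mscale//; last first.
  by move=> x _; rewrite lee_fin sqdist_ge0.
rewrite EFinM lee_wpmul2l ?lee_fin// ge0_integral_pushforward//; last first.
  by move=> x _; rewrite lee_fin sqdist_ge0.
rewrite preimage_setT.
apply: (@le_trans _ _ (\int[mrestr P (mQ k)]_x (c k)%:E)%E).
  (* The bound [c k] is known only on [Q k], whose complement is null for the restricted measure. *)
  apply: ae_ge0_le_integral => //=.
  - by move=> x _; rewrite lee_fin sqdist_ge0.
  - exact: measurableT_comp mf (measurable_pairz k).
  - by move=> x _; rewrite lee_fin.
  - exists (~` Q k); split.
    + exact: measurableC.
    + by rewrite /mrestr setICl measure0.
    + by move=> x /= /not_implyP[_ +] Qx; apply; rewrite lee_fin; exact: Hc.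
by rewrite integral_cst//= /mrestr setTI -[X in (_ * X <= _)%E]fineK ?prob_fin_num.
Qed.

End coupling.

(** * Splitting along a partition, and a grid of small cubes *)

Lemma fine_probC d (T : measurableType d) (R : realType) (P : probability T R)
    (A : set T) : measurable A -> fine (P (~` A)) = 1 - fine (P A).
Proof.
move=> mA; have := probability_setC P mA.
have := prob_fin_num P mA; have := prob_fin_num P (measurableC mA).
case: (P (~` A)) => // r _; case: (P A) => // s _; by rewrite -EFinB => -[].
Qed.

(** The traces on [A] sum to at most the mass of [A], likewise for the complement, and together the
    two sums reach 1; so both bounds are equalities. *)
Lemma prob_split d (T : measurableType d) (R : realType) (P : probability T R)
    (I : finType) (F : I -> set T) :
  (forall i, measurable (F i)) -> trivIset setT F -> \sum_i fine (P (F i)) = 1 ->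
  forall A, measurable A -> \sum_i fine (P (A `&` F i)) = fine (P A).
Proof.
move=> mF tF F1.
have sub A : measurable A -> \sum_i fine (P (A `&` F i)) <= fine (P A).
  move=> mA; rewrite -fine_prob_partition; last 2 first.
  - by move=> i; exact: measurableI.
  - exact: trivIset_setIl.
  apply: fine_prob_le => //; last by move=> x [i _ []].
  by apply: fin_bigcup_measurable => [|i _]; [exact: finite_finset|exact: measurableI].
move=> A mA; have mAC := measurableC mA.
have := sub _ mA; have := sub _ mAC; rewrite fine_probC//.
have : \sum_i fine (P (F i)) <=
    \sum_i fine (P (~` A `&` F i)) + \sum_i fine (P (A `&` F i)).
  rewrite -big_split/=; apply: ler_sum => i _.
  have := @fine_prob_cover _ _ _ P bool (F i)
    (fun b => (if b then ~` A else A) `&` F i) (mF i).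
  rewrite big_bool/=; apply; first by case; exact: measurableI.
  by move=> x Fx; have [Ax|nAx] := pselect (A x); [exists false|exists true].
rewrite F1 => *; apply/eqP; rewrite eq_le; apply/andP; split; lra.
Qed.

Lemma grid_partition (R : realType) (m : nat) (M r : R) : (0 < m)%N -> 0 < r ->
  exists (I : finType) (y : I -> 'rV[R]_m) (Q : I -> set (m.-tuple R)) (D : R),
  [/\ injective y, forall i, measurable (Q i), trivIset setT Q,
      [set t | forall k, `|tnth t k| <= M] `<=` \bigcup_i Q i &
      forall i t, Q i t -> sqdist (t, row2tup (y i)) <= r /\
        forall j, sqdist (t, row2tup (y j)) <= D].
Proof.
(* Side of the cubes: a point within [d] of the corner in every coordinate is at squared distance at
   most [m * d ^+ 2 = r]. *)
move=> m0 r0; pose d := Num.sqrt (r / m%:R).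
have mR0 : 0 < m%:R :> R by rewrite ltr0n.
have d0 : 0 < d by rewrite sqrtr_gt0 divr_gt0.
have d2 : m%:R * d ^+ 2 = r.
  by rewrite sqr_sqrtr ?divr_ge0 ?ltW// mulrC divfK// gt_eqF.
(* With corners starting at [- M], [n.+1] cubes per axis reach beyond [M]. The absolute value is
   there because the sign of [M] is not given. *)
pose n := Num.bound `|2 * M / d|.
pose I : finType := {ffun 'I_m -> 'I_n.+1}.
pose y (i : I) : 'rV[R]_m := \row_k (- M + d * (i k)%:R).
pose Q (i : I) := [set t : m.-tuple R | forall k, tnth t k \in `[y i ord0 k, y i ord0 k + d[].
have sq (t : m.-tuple R) (x : 'rV[R]_m) e : (forall k, `|tnth t k - x ord0 k| <= e) ->
    sqdist (t, row2tup x) <= m%:R * e ^+ 2.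
  move=> H; have -> : m%:R * e ^+ 2 = \sum_(k < m) e ^+ 2.
    by rewrite sumr_const card_ord mulr_natl.
  apply: ler_sum => k _ /=; rewrite tnth_mktuple -real_normK ?num_real//.
  have e0 : 0 <= e by exact: le_trans (normr_ge0 _) (H k).
  by apply: lerXn2r; rewrite ?nnegrE.
(* All cubes and corners lie within [d + d * n] above [- M] in each coordinate, whence the global
   bound [D]. *)
exists I, y, Q, (m%:R * (d + d * n%:R) ^+ 2); split.
- move=> i j /rowP ij; apply/ffunP => k; apply/val_inj.
  have := ij k; rewrite !mxE => /addrI/(mulfI (lt0r_neq0 d0))/eqP.
  by rewrite eqr_nat => /eqP.
- move=> i; rewrite (_ : Q i = \bigcap_(k in setT)
      [set t | tnth t k \in `[y i ord0 k, y i ord0 k + d[]); last first.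
    by apply/seteqP; split=> t H k; [move=> _|]; exact: (H k).
  apply: fin_bigcap_measurable => [|k _]; first exact: finite_finset.
  have := @measurable_tnth _ R m k measurableT _ (measurable_itv `[y i ord0 k, y i ord0 k + d[).
  by rewrite setTI.
- apply/trivIsetP => i j _ _ ij; rewrite -subset0 => t [ti tj].
  move/eqP: ij; apply; apply/ffunP => k; apply/val_inj.
  (* Half-open intervals of the grid that share a point have the same index; each inequality between
     the indices comes from one use of this fact. *)
  have aux (a b : nat) : - M + d * a%:R <= tnth t k -> tnth t k < - M + d * b%:R + d -> (a <= b)%N.
    move=> h1 h2; have : d * a%:R < d * (b.+1)%:R by rewrite -natr1; lra.
    by rewrite ltr_pM2l// ltr_nat.
  have := ti k; have := tj k; rewrite !mxE !in_itv/= => /andP[j1 j2] /andP[i1 i2].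
  by apply/eqP; rewrite eqn_leq !aux.
- move=> t /= tM; pose q k := (tnth t k + M) / d.
  have q0 k : 0 <= q k.
    by apply: divr_ge0; [|exact: ltW]; have := tM k; rewrite ler_norml => /andP[]; lra.
  have qn k : (Num.truncn (q k) < n.+1)%N.
    rewrite ltnS ltnW// -(ltr_nat R); apply: (@le_lt_trans _ _ (q k)).
      by have /andP[] := truncn_itv (q0 k).
    apply: le_lt_trans (archi_boundP (normr_ge0 (2 * M / d))).
    rewrite (le_trans _ (ler_norm _))// ler_pM2r ?invr_gt0//.
    by have := tM k; rewrite ler_norml => /andP[]; lra.
  exists [ffun k => Ordinal (qn k)] => // k; rewrite in_itv/= !mxE ffunE/=.
  have /andP[h1 h2] := truncn_itv (q0 k).
  move: h1 h2; rewrite ler_pdivlMr// ltr_pdivrMr// -natr1.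
  by move=> *; apply/andP; split; lra.
- move=> i t ti; split=> [|j].
    rewrite -d2; apply: sq => k; have := ti k; rewrite in_itv/= => /andP[? ?].
    by rewrite ler_norml; apply/andP; split; lra.
  apply: sq => k; have := ti k; rewrite in_itv/= !mxE => /andP[? ?].
  have di : d * (i k)%:R <= d * n%:R by rewrite ler_pM2l// ler_nat -ltnS.
  have dj : d * (j k)%:R <= d * n%:R by rewrite ler_pM2l// ler_nat -ltnS.
  have di0 : 0 <= d * (i k)%:R by rewrite mulr_ge0// ltW.
  have dj0 : 0 <= d * (j k)%:R by rewrite mulr_ge0// ltW.
  by rewrite ler_norml; apply/andP; split; lra.
Qed.

(** * Transport cost to the law of the network gradient *)

Lemma W2sq_quantized (R : realType) (m : nat) (P : probability (m.-tuple R) R)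
    (I : finType) (i0 : I) (Q : I -> set (m.-tuple R)) (z : I -> m.-tuple R)
    (q : I -> R) (nu : set (m.-tuple R) -> \bar R) (r D : R) :
  (forall i, measurable (Q i)) -> trivIset setT Q ->
  \sum_i fine (P (Q i)) = 1 -> (forall i, 0 < fine (P (Q i))) ->
  (forall i, 0 <= q i) -> \sum_i q i = 1 ->
  (forall i, i != i0 -> q i <= fine (P (Q i))) ->
  0 <= r -> 0 <= D ->
  (forall i t, Q i t -> sqdist (t, z i) <= r /\ forall j, sqdist (t, z j) <= D) ->
  (forall B, measurable B -> nu B = (\sum_i q i * \1_B (z i))%:E) ->
  (W2sq P nu <= (r + D * \sum_(i | i != i0) (fine (P (Q i)) - q i))%:E)%E.
Proof.
move=> mQ tQ p1 p0 q0 q1 qp r0 D0 Qz Hnu.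
pose p i := fine (P (Q i)).
(* Fraction of [Q i] that stays with its own target [z i]: everything for [i0], and just enough to
   deliver [q i] otherwise. *)
pose l i := if i == i0 then 1 else q i / p i.
have lp i : i != i0 -> l i * p i = q i.
  by move=> /negbTE ii0; rewrite /l ii0 divfK// gt_eqF// p0.
have l01 i : 0 <= l i <= 1.
  rewrite /l; case: eqVneq => [_|ii0]; first by rewrite ler01 lexx.
  rewrite ler_pdivrMr ?p0// mul1r qp// andbT.
  by apply: divr_ge0 => //; exact: ltW (p0 i).
(* [(i, true)] is the part of [Q i] kept at [z i], at cost at most [r]; [(i, false)] is the excess
   sent to [z i0], at cost at most [D]. *)
pose K : finType := (I * bool)%type.
pose w (k : K) : R := if k.2 then l k.1 else 1 - l k.1.
have w0 k : 0 <= w k.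
  by rewrite /w; have /andP[? ?] := l01 k.1; case: ifP => _ //; rewrite subr_ge0.
pose zK (k : K) := if k.2 then z k.1 else z i0.
have big_K (F : K -> R) : \sum_k F k = \sum_i (F (i, true) + F (i, false)).
  rewrite (eq_bigr (fun k => F (k.1, k.2))) => [|[]//].
  rewrite -(pair_bigA _ (fun i b => F (i, b)))/=.
  by apply: eq_bigr => i _; rewrite big_bool.
pose c (k : K) : R := if k.2 then r else D.
have HP A : measurable A -> \sum_k w k * fine (P (A `&` Q k.1)) = fine (P A).
  move=> mA; rewrite big_K -(prob_split mQ tQ p1 mA).
  by apply: eq_bigr => i _; rewrite /w /=; ring.
have := @mixture_cost R m P K (i0, true) (fun k => Q k.1) (fun k => mQ k.1)
  w w0 zK HP nu c.
move=> /(_ _ _ _)/le_trans; apply.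
- by move=> k; rewrite /c; case: ifP.
- move=> [i b] t /= ti; have [h1 h2] := Qz _ _ ti.
  by rewrite /zK /c/=; case: b.
- move=> B mB; rewrite Hnu// big_K; congr (_%:E).
  rewrite [RHS](eq_bigr (fun i => l i * p i * \1_B (z i) + (p i - l i * p i) * \1_B (z i0))); last first.
    by move=> i _; rewrite /w/zK/= -/(p i); ring.
  rewrite [in RHS]big_split/= -mulr_suml sumrB.
  rewrite p1 (bigD1 i0)//= [in RHS](bigD1 i0)//= [X in _ = _ + (1 - X) * _](bigD1 i0)//=.
  have -> : \sum_(i | i != i0) l i * p i * \1_B (z i) = \sum_(i | i != i0) q i * \1_B (z i).
    by apply: eq_bigr => i /lp ->.
  have -> : \sum_(i | i != i0) l i * p i = \sum_(i | i != i0) q i.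
    by apply: eq_bigr => i /lp ->.
  (* Both families of masses sum to 1, so [p i0] plus all the excesses is exactly [q i0]. *)
  have -> : q i0 = 1 - \sum_(i | i != i0) q i.
    by move: q1; rewrite (bigD1 i0)//= => <-; ring.
  by rewrite /l eqxx; ring.
rewrite lee_fin big_K.
rewrite (eq_bigr (fun i => r * (l i * p i) + D * (p i - l i * p i))); last first.
  by move=> i _; rewrite /w/c/= -/(p i); ring.
rewrite big_split/= lerD//.
  rewrite -mulr_sumr ler_piMr// -p1; apply: ler_sum => i _.
  by apply: ler_piMl; [exact: ltW (p0 i)|have /andP[] := l01 i].
rewrite -mulr_sumr ler_wpM2l// (bigD1 i0)//= {1}/l eqxx mul1r subrr add0r.
by apply: ler_sum => i /lp ->.
Qed.

Lemma pushforward_net_grad (R : realType) (m : nat) (mu : 'rV[R]_m) (S : 'M[R]_m)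
    (G : probability (m.-tuple R) R) (I : finType) (i0 : I) (y : I -> 'rV[R]_m)
    (h : I -> R) : posdef S -> gaussian mu S G -> injective y ->
  exists N : relu_net R m, forall B, measurable B ->
    pushforward G (net_grad N) B =
    (\sum_i fine (G (cell y h i)) * \1_B (row2tup (y i)))%:E.
Proof.
move=> pS hG yI; have [N [Ncell Ntie]] := net_grad_cell h i0 yI.
exists N => B mB; rewrite /pushforward.
have mcell := measurable_cell y h.
have mU : measurable (\bigcup_i cell y h i).
  by apply: fin_bigcup_measurable => [|i _]; [exact: finite_finset|].
(* The preimage is a finite union of cells, together with the whole complement of the cells when [B]
   contains the default gradient 0. *)
have mpre : measurable (net_grad N @^-1` B).
  rewrite (_ : _ @^-1` B =
    (\bigcup_(i in [set i | B (row2tup (y i))]) cell y h i) `|`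
    (if row2tup 0 \in B then ~` \bigcup_i cell y h i else set0)); last first.
    apply/seteqP; split=> t /=.
      have [[i it]|tN] := pselect (exists i, cell y h i t).
        by rewrite (Ncell _ _ it) => By; left; exists i.
      rewrite Ntie; last by move=> i it; apply: tN; exists i.
      by move=> B0; right; rewrite mem_set// => -[i _ it]; apply: tN; exists i.
    case=> [[i /= By it]|]; first by rewrite (Ncell _ _ it).
    case: ifPn => // /set_mem B0 tN; rewrite Ntie// => i it.
    by apply: tN; exists i.
  apply: measurableU.
    by apply: fin_bigcup_measurable => [|i _]; [exact: finite_finset|].
  by case: ifP => // _; exact: measurableC.
rewrite -[LHS]fineK ?prob_fin_num//; congr (_%:E).
have mass1 := mass_sum pS hG yI i0 h.
(* The cells carry full Gaussian mass, and on each of them the gradient is constant. *)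
rewrite -(prob_split mcell (@cell_disjoint _ _ _ y h) mass1 mpre).
apply: eq_bigr => i _; rewrite indicE.
have [By|By] := boolP (row2tup (y i) \in B).
  rewrite mulr1; congr (fine (G _)); apply/seteqP; split=> [t []//|t it].
  by split=> //=; rewrite (Ncell _ _ it); exact: set_mem.
rewrite mulr0 (_ : _ `&` _ = set0) ?measure0//.
rewrite -subset0 => t /= [+ it]; rewrite (Ncell _ _ it) => By'.
by move/negP: By; apply; exact: mem_set.
Qed.

Theorem theorem1 (R : realType) (m : nat) (hm : (0 < m)%N)
  (P : probability (m.-tuple R) R)
  (hP : exists M : R, P [set x | forall i : 'I_m, `|tnth x i| <= M] = 1%E)
  (mu : 'rV[R]_m) (S : 'M[R]_m) (hS : posdef S)
  (G : probability (m.-tuple R) R) (hG : gaussian mu S G)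
  (eps : R) (heps : 0 < eps) :
  exists N : relu_net R m,
    (W2sq P (pushforward G (net_grad N)) < eps%:E)%E.
Proof.
(* One half of [eps] pays for displacements inside the cubes, the other for the excess mass. *)
have [M PM] := hP; have eps2 : 0 < eps / 2 by lra.
have [I [y [Q [D [yI mQ tQ cubeQ Qy]]]]] := grid_partition M hm eps2.
pose p i := fine (P (Q i)).
have p_ge0 i : 0 <= p i by exact: fine_ge0.
have mU : measurable (\bigcup_i Q i).
  by apply: fin_bigcup_measurable => [|i _]; [exact: finite_finset|].
have p1 : \sum_i p i = 1.
  rewrite /p -fine_prob_partition//; apply/eqP; rewrite eq_le; apply/andP; split.
    by rewrite -lee_fin fineK ?prob_fin_num// probability_le1.
  have -> : 1 = fine (P [set x | forall i : 'I_m, `|tnth x i| <= M]) by rewrite PM.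
  apply: fine_prob_le => //.
  rewrite (_ : mkset _ = \bigcap_(i in setT) [set x : m.-tuple R | tnth x i \in `[- M, M]]).
    apply: fin_bigcap_measurable => [|k _]; first exact: finite_finset.
    by have := @measurable_tnth _ R m k measurableT _ (measurable_itv `[- M, M]); rewrite setTI.
  apply/seteqP; split=> x H k; first by move=> _; rewrite /= in_itv/= -ler_norml; exact: H.
  by have := H k Logic.I; rewrite /= in_itv/= -ler_norml.
(* Only cubes of positive mass are kept: the heights need positive targets, and the coupling divides
   by these masses. *)
pose J : finType := {i : I | i \in [pred i | 0 < p i]}.
have pJ (j : J) : 0 < p (val j) by exact: valP j.
have pJ1 : \sum_(j : J) p (val j) = 1.
  rewrite -big_sub -p1 big_mkcond; apply: eq_bigr => i _.
  by rewrite inE; case: ltgtP (p_ge0 i).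
have [j0 _] : exists j : J, true.
  case: (pickP (fun _ : J => true)) => [j _|noJ]; first by exists j.
  by move/esym/eqP: pJ1; rewrite big_pred0// oner_eq0.
have yJ : injective (fun j : J => y (val j)) by move=> j k /yI/val_inj.
(* The total excess is at most [#|J| * e], which at cost [|D|] stays strictly below [eps / 2]. The
   absolute value supplies the nonnegative cost bound. *)
pose e := eps / 2 / (`|D| * #|J|%:R + 1).
have den0 : 0 < `|D| * #|J|%:R + 1 by rewrite ltr_wpDl// mulr_ge0.
have e0 : 0 < e by exact: divr_gt0.
have [h hh] := balanced_heights hS hG yJ j0 pJ pJ1 e0.
have [N HN] := pushforward_net_grad j0 h hS hG yJ.
exists N.
have := @W2sq_quantized R m P J j0 (fun j => Q (val j))
  (fun j => row2tup (y (val j))) _ _ (eps / 2) `|D| _ _ pJ1 pJ _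
  (mass_sum hS hG yJ j0 h) _ (ltW eps2) (normr_ge0 _) _ HN.
move=> /(_ _ _ _ _ _)/le_lt_trans; apply.
- by move=> j; exact: mQ.
- apply/trivIsetP => j k _ _ jk; by move/trivIsetP: tQ; apply.
- by move=> j; exact: fine_ge0.
- by move=> j /hh/andP[].
- move=> j t /Qy[h1 h2]; split=> // k.
  by rewrite (le_trans (h2 _))// ler_norm.
rewrite lte_fin.
have : \sum_(j | j != j0) (p (val j) - fine (G (cell (fun j => y (val j)) h j)))
    <= #|J|%:R * e.
  rewrite mulr_natl -sumr_const [leRHS](bigD1 j0)//= ler_wpDl ?(ltW e0)//.
  by apply: ler_sum => j /hh/andP[? ?]; rewrite lerBlDl -lerBlDr.
move=> /(ler_wpM2l (normr_ge0 D)) le1.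
have : `|D| * (#|J|%:R * e) < eps / 2.
  by rewrite mulrA /e mulrCA gtr_pMr// ltr_pdivrMr// mul1r ltrDl.
by move: le1; rewrite /p; lra.
Qed.
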